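(* Let $A,E\in\mathbb{C}^{n\times n}$, $B\in\mathbb{C}^{n\times m}$, $C\in\mathbb{C}^{p\times n}$, $D\in\mathbb{C}^{p\times m}$ satisfy the standing assumptions in the context, and let $H(s)=C(sE-A)^{-1}B+D$. Let $\mu\in\mathbb{C}$ not belong to the spectrum of $L(s)=A-sE$, and let $q\ge 0$ be an integer. Let $\mathcal{V},\mathcal{W}\subseteq\mathbb{C}^n$ be two subspaces of equal dimension. Set $\mathcal{V}_{\rm up}=\mathcal{V}+\mathcal{V}_\mu$ and $\mathcal{W}_{\rm up}=\mathcal{W}+\mathcal{W}_\mu$, where $$\mathcal{V}_\mu=\sum_{j=0}^{q}\mathrm{Ran}\Big[\big\{(A-\mu E)^{-1}E\big\}^j(A-\mu E)^{-1}B\,P_R(\mu)\Big],$$ $$\mathcal{W}_\mu=\sum_{j=0}^{q}\mathrm{Ran}\Big[\Big(C(A-\mu E)^{-1}\big\{E(A-\mu E)^{-1}\big\}^j\Big)^*P_L(\mu)\Big],$$ and $$P_R(\mu)=\begin{cases}I_m & m\le p\\ H(\mu)^* & m>p\end{cases},\qquad P_L(\mu)=\begin{cases}I_p & p\le m\\ H(\mu) & p>m\end{cases}.$$ Assume that $\mathcal{V}_{\rm up}$ and $\mathcal{W}_{\rm up}$ have equal dimension, and let $H_{\rm red}$ denote the reduced transfer function associated with $(\mathcal{W}_{\rm up},\mathcal{V}_{\rm up})$ as defined in the context. If $\mu$ is not a pole of $H_{\rm red}$, then: 1. $H(\mu)=H_{\rm red}(\mu)$; 2. $H^{(j)}(\mu)=H_{\rm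 red}^{(j)}(\mu)$ for $j=1,\dots,q$; 3. $P_L(\mu)^*H^{(j)}(\mu)P_R(\mu)=P_L(\mu)^*H_{\rm red}^{(j)}(\mu)P_R(\mu)$ for $j=q+1,\dots,2q+1$. Here the superscript $(j)$ denotes the $j$th derivative with respect to $s$.
   Context: Standing assumptions: $n\ge m$, $n\ge p$; the pencil $L(s)=A-sE$ is regular ($\det L(s)\not\equiv0$) with simple finite eigenvalues; if $E$ is singular, then $0$ is a semisimple eigenvalue of $E-sA$ (index one). Reduced transfer function: given subspaces $\mathcal{W}',\mathcal{V}'\subseteq\mathbb{C}^n$ of equal dimension, let $W,V$ be matrices whose columns form orthonormal bases of $\mathcal{W}',\mathcal{V}'$. The reduced transfer function is $$CV(sW^*EV-W^*AV)^{-1}W^*B+D,$$ which does not depend on the choice of bases. The poles of the reduced system are the finite eigenvalues of the pencil $W^*AV-sW^*EV$; ''$\mu$ is not a pole'' means that $\mu W^*EV-W^*AV$ is invertible. $\mathrm{Ran}$ denotes the column space, $^*$ the conjugate transpose, and sums of subspaces are not required to be direct. *)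

(* Defs.v *)
From HB Require Import structures.
From mathcomp Require Export all_boot all_order all_algebra.
From mathcomp Require Export sesquilinear spectral.
From mathcomp Require Export complex.
From mathcomp Require Export reals topology normedtype derive.

Set Implicit Arguments.
Unset Strict Implicit.
Unset Printing Implicit Defensive.

Export Order.TTheory GRing.Theory Num.Theory.
Export numFieldNormedType.Exports.

Local Open Scope ring_scope.
Local Open Scope complex_scope.
Local Open Scope sesquilinear_scope.

Definition pencil_poly (R : realType) (n : nat) (A E : 'M[R[i]]_n) :
    {poly R[i]} :=
  \det (map_mx polyC A - 'X *: map_mx polyC E).

Definition regular_pencil (R : realType) (n : nat) (A E : 'M[R[i]]_n) : Prop :=
  pencil_poly A E != 0.

Definition finite_eigenvalue (R : realType) (n : nat) (A E : 'M[R[i]]_n)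
    (z : R[i]) : Prop :=
  root (pencil_poly A E) z.

Definition simple_eigenvalue (R : realType) (n : nat) (A E : 'M[R[i]]_n)
    (z : R[i]) : Prop :=
  finite_eigenvalue A E z /\ mup z (pencil_poly A E) = 1%N.

(* Semisimple: algebraic and geometric multiplicities agree, the latter being
   dim ker (A - z E). *)
Definition semisimple_eigenvalue (R : realType) (n : nat) (A E : 'M[R[i]]_n)
    (z : R[i]) : Prop :=
  finite_eigenvalue A E z /\
  mup z (pencil_poly A E) = (n - \rank (A - z *: E)%R)%N.

Definition standing_assumptions (R : realType) (n m p : nat)
    (A E : 'M[R[i]]_n) : Prop :=
  [/\ (m <= n)%N, (p <= n)%N, regular_pencil A E,
      forall z, finite_eigenvalue A E z -> simple_eigenvalue A E z &
      E \notin unitmx -> semisimple_eigenvalue E A 0].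

Definition transfer (R : realType) (n m p : nat) (A E : 'M[R[i]]_n)
    (B : 'M[R[i]]_(n, m)) (C : 'M[R[i]]_(p, n)) (D : 'M[R[i]]_(p, m))
    (s : R[i]) : 'M[R[i]]_(p, m) :=
  C *m invmx (s *: E - A) *m B + D.

Definition Ran (R : realType) (n k : nat) (M : 'M[R[i]]_(n, k)) :
    {vspace 'cV[R[i]]_n} :=
  <<[seq col j M | j : 'I_k]>>%VS.

Definition orthonormal_basis_mx (R : realType) (n r : nat)
    (M : 'M[R[i]]_(n, r)) (U : {vspace 'cV[R[i]]_n}) : Prop :=
  M ^t* *m M = 1%:M /\ Ran M = U.

Definition reduced_transfer (R : realType) (n m p r : nat) (A E : 'M[R[i]]_n)
    (B : 'M[R[i]]_(n, m)) (C : 'M[R[i]]_(p, n)) (D : 'M[R[i]]_(p, m))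
    (W V : 'M[R[i]]_(n, r)) : R[i] -> 'M[R[i]]_(p, m) :=
  transfer (W ^t* *m A *m V) (W ^t* *m E *m V)
           (W ^t* *m B) (C *m V) D.

Definition is_pole (R : realType) (r : nat) (Ar Er : 'M[R[i]]_r) (z : R[i]) : Prop :=
  z *: Er - Ar \notin unitmx.

Definition PR (R : realType) (m p : nat) (Hmu : 'M[R[i]]_(p, m)) :
    'M[R[i]]_(m, if (m <= p)%N then m else p) :=
  if (m <= p)%N as b return 'M[R[i]]_(m, if b then m else p)
  then 1%:M else Hmu ^t*.

Definition PL (R : realType) (m p : nat) (Hmu : 'M[R[i]]_(p, m)) :
    'M[R[i]]_(p, if (p <= m)%N then p else m) :=
  if (p <= m)%N as b return 'M[R[i]]_(p, if b then p else m)
  then 1%:M else Hmu.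

Definition Vmu (R : realType) (n m p q : nat) (A E : 'M[R[i]]_n)
    (B : 'M[R[i]]_(n, m)) (Hmu : 'M[R[i]]_(p, m)) (mu : R[i]) :
    {vspace 'cV[R[i]]_n} :=
  (\sum_(j < q.+1)
     Ran (((invmx (A - mu *: E) *m E) ^+ j)%R
            *m invmx (A - mu *: E) *m B *m PR Hmu))%VS.

Definition Wmu (R : realType) (n m p q : nat) (A E : 'M[R[i]]_n)
    (C : 'M[R[i]]_(p, n)) (Hmu : 'M[R[i]]_(p, m)) (mu : R[i]) :
    {vspace 'cV[R[i]]_n} :=
  (\sum_(j < q.+1)
     Ran ((C *m invmx (A - mu *: E)
             *m ((E *m invmx (A - mu *: E)) ^+ j)%R) ^t* *m PL Hmu))%VS.

(* [R[i]^o] is the normed module of [R[i]] over itself, so that [derive1n] is the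
   complex derivative. *)
Definition derive_mx (R : realType) (p m : nat)
    (F : R[i] -> 'M[R[i]]_(p, m)) (k : nat) (s : R[i]) : 'M[R[i]]_(p, m) :=
  \matrix_(i, j) (derive1n k (fun z => F z i j : (R[i])^o) s : R[i]).

(* Main.v *)
(** With L = A - mu E, X = L^-1 and Y = V (W^* L V)^-1 W^*, the k-th derivatives
    at mu (k > 0) of the full and reduced transfer functions are - k! C (X E)^k X B
    and - k! C (Y E)^k Y B.  Now Y L fixes Ran V and L Y fixes the rows spanned by
    W^*, so by induction Y may replace X in (X E)^j X B P_R and in
    P_L^* C X (E X)^j for j <= q.  At least one of P_L, P_R is the identity, which
    gives the moments up to q; for the others, split
    C (X E)^(a+q+1) X B = [C X (E X)^a] E [(X E)^q X B] and use both sides. *)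
Require Import Defs.
From mathcomp Require Import boolp functions.

Set Implicit Arguments.
Unset Strict Implicit.
Unset Printing Implicit Defensive.

Local Open Scope ring_scope.
Local Open Scope complex_scope.
Local Open Scope sesquilinear_scope.

(** * Moments under an oblique projection, over any field *)

Section MomentMatching.
Variable F : fieldType.

Lemma unitmxN n (A : 'M[F]_n) : (- A \in unitmx) = (A \in unitmx).
Proof. by rewrite -scaleN1r unitmxZ ?unitrN1. Qed.

Lemma invmxN n (A : 'M[F]_n) : invmx (- A) = - invmx A.
Proof.
have [Au|Anu] := boolP (A \in unitmx).
  by rewrite -scaleN1r invmxZ ?invrN1 ?scaleN1r ?unitmxN.
(* On a singular matrix [invmx] returns its argument, so both sides are [- A]. *)
by rewrite /invmx unitmxN (negbTE Anu).
Qed.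

(** The factors may be rectangular: besides exchanging [T *m E] and [E *m T], this moves [V] across
    powers of matrices of size [r]. *)
Lemma mulmx_exp_shift n k (P : 'M[F]_(n, k)) (Q : 'M[F]_(k, n)) j :
  (P *m Q) ^+ j *m P = P *m (Q *m P) ^+ j.
Proof.
elim: j => [|j IHj]; first by rewrite !expr0 mul1mx mulmx1.
by rewrite !exprS -!mulmxE -mulmxA IHj !mulmxA.
Qed.

Variables (n r : nat) (L E : 'M[F]_n) (V : 'M[F]_(n, r)) (W : 'M[F]_(r, n)).
Hypothesis WLV_unit : W *m L *m V \in unitmx.

Let X := invmx L.
Let Xr := invmx (W *m L *m V).
(* [Y *m L] is the oblique projector onto the columns of [V], and [L *m Y] fixes
   the rows of [W]. *)
Let Y := V *m Xr *m W.

Lemma galerkin_fix_col k (Z : 'M[F]_(r, k)) : Y *m L *m (V *m Z) = V *m Z.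
Proof.
have -> : Y *m L *m (V *m Z) = V *m (Xr *m (W *m L *m V)) *m Z.
  by rewrite /Y !mulmxA.
by rewrite mulVmx // mulmx1.
Qed.

Lemma galerkin_fix_row k (Z : 'M[F]_(k, r)) : Z *m W *m L *m Y = Z *m W.
Proof.
have -> : Z *m W *m L *m Y = Z *m ((W *m L *m V) *m Xr) *m W.
  by rewrite /Y !mulmxA.
by rewrite mulmxV // mulmx1.
Qed.

Hypothesis L_unit : L \in unitmx.

Lemma galerkin_moment_col k (B : 'M[F]_(n, k)) q :
  (forall j, (j <= q)%N -> exists Z, (X *m E) ^+ j *m X *m B = V *m Z) ->
  forall j, (j <= q)%N -> (Y *m E) ^+ j *m Y *m B = (X *m E) ^+ j *m X *m B.
Proof.
move=> span_V; elim=> [|j IHj] jq.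
  have [Z] := span_V 0 jq; rewrite !expr0 !mul1mx => XB.
  by rewrite XB -(galerkin_fix_col Z) -XB -(mulmxA Y) mulKVmx.
have [Z XjB] := span_V _ jq.
(* This inserts [Y *m L] before the moment of order [j.+1]; [L] then cancels its leading [X],
   leaving [Y *m E] applied to the moment of order [j]. *)
rewrite XjB -(galerkin_fix_col Z) -XjB.
have -> : (Y *m E) ^+ j.+1 *m Y *m B = Y *m (E *m ((Y *m E) ^+ j *m Y *m B)).
  by rewrite exprS -mulmxE !mulmxA.
rewrite IHj ?(ltnW jq) // -(mulmxA Y); congr (Y *m _).
by rewrite exprS -mulmxE -!mulmxA mulKVmx.
Qed.

Lemma galerkin_moment_row k (C : 'M[F]_(k, n)) q :
  (forall j, (j <= q)%N -> exists Z, C *m X *m (E *m X) ^+ j = Z *m W) ->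
  forall j, (j <= q)%N -> C *m Y *m (E *m Y) ^+ j = C *m X *m (E *m X) ^+ j.
Proof.
move=> span_W; elim=> [|j IHj] jq.
  have [Z] := span_W 0 jq; rewrite !expr0 !mulmx1 => CX.
  by rewrite CX -(galerkin_fix_row Z) -CX mulmxKV.
have [Z CXj] := span_W _ jq.
rewrite CXj -(galerkin_fix_row Z) -CXj.
have -> : C *m Y *m (E *m Y) ^+ j.+1 = C *m Y *m (E *m Y) ^+ j *m E *m Y.
  by rewrite exprSr -mulmxE !mulmxA.
rewrite IHj ?(ltnW jq) //; congr (_ *m Y).
by rewrite exprSr -mulmxE !mulmxA mulmxKV.
Qed.

(** A right inverse of [P] recovers [B] from [B *m P], so control of the columns alone settles the
    moments for every [C]. *)
Lemma galerkin_moment_right k k' l (B : 'M[F]_(n, k)) (P : 'M[F]_(k, k'))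
    (C : 'M[F]_(l, n)) q :
  (exists Z, P *m Z = 1%:M) ->
  (forall j, (j <= q)%N -> exists Z, (X *m E) ^+ j *m X *m (B *m P) = V *m Z) ->
  forall j, (j <= q)%N ->
  C *m (Y *m E) ^+ j *m Y *m B = C *m (X *m E) ^+ j *m X *m B.
Proof.
move=> [Z PZ] span_V j jq.
have BE : B = B *m P *m Z by rewrite -mulmxA PZ mulmx1.
rewrite BE -!(mulmxA C) !(mulmxA _ (B *m P)).
by rewrite (galerkin_moment_col span_V).
Qed.

Lemma galerkin_moment_left k l l' (B : 'M[F]_(n, k)) (P : 'M[F]_(l', l))
    (C : 'M[F]_(l, n)) q :
  (exists Z, Z *m P = 1%:M) ->
  (forall j, (j <= q)%N -> exists Z, P *m C *m X *m (E *m X) ^+ j = Z *m W) ->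
  forall j, (j <= q)%N ->
  C *m (Y *m E) ^+ j *m Y *m B = C *m (X *m E) ^+ j *m X *m B.
Proof.
move=> [Z PZ] span_W j jq.
have shift (T : 'M[F]_n) :
    C *m (T *m E) ^+ j *m T = Z *m (P *m C *m T *m (E *m T) ^+ j).
  by rewrite -mulmxA mulmx_exp_shift !mulmxA PZ mul1mx.
by rewrite !shift (galerkin_moment_row span_W).
Qed.

Lemma galerkin_moment_mid k k' l l' (B : 'M[F]_(n, k)) (Q : 'M[F]_(k, k'))
    (P : 'M[F]_(l', l)) (C : 'M[F]_(l, n)) q :
  (forall j, (j <= q)%N -> exists Z, (X *m E) ^+ j *m X *m (B *m Q) = V *m Z) ->
  (forall j, (j <= q)%N -> exists Z, P *m C *m X *m (E *m X) ^+ j = Z *m W) ->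
  forall j, (q < j <= q.*2.+1)%N ->
  P *m (C *m (Y *m E) ^+ j *m Y *m B) *m Q =
  P *m (C *m (X *m E) ^+ j *m X *m B) *m Q.
Proof.
move=> span_V span_W j /andP[qj j2q].
have split_moment (T : 'M[F]_n) : P *m (C *m (T *m E) ^+ j *m T *m B) *m Q =
    P *m C *m T *m (E *m T) ^+ (j - q.+1) *m E *m
      ((T *m E) ^+ q *m T *m (B *m Q)).
  (* The exponent is read as [(j - q.+1) + 1 + q]; the middle factor supplies the [E] between the
     two halves. *)
  rewrite -{1}(subnK qj) exprD exprS -!mulmxE.
  rewrite -(mulmxA (P *m C) T) -mulmx_exp_shift.
  by rewrite !mulmxA.
rewrite !split_moment (galerkin_moment_col span_V) //.
(* The row half needs [j - q.+1 <= q], which is exactly the upper bound on [j]. *)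
by rewrite (galerkin_moment_row span_W) // leq_subLR addSn addnn.
Qed.

(** Lifts the reduced system back to size [n], so that it differs from the full one only by [Y] in
    place of [X]. *)
Lemma reduced_moment k l (B : 'M[F]_(n, k)) (C : 'M[F]_(l, n)) j :
  C *m V *m (Xr *m (W *m E *m V)) ^+ j *m Xr *m (W *m B) =
  C *m (Y *m E) ^+ j *m Y *m B.
Proof.
have e : V *m (Xr *m (W *m E *m V)) ^+ j = (Y *m E) ^+ j *m V.
  have := mulmx_exp_shift V (Xr *m W *m E) j.
  by rewrite /Y !mulmxA => ->.
by rewrite -(mulmxA C V) e /Y !mulmxA.
Qed.

End MomentMatching.

(** * Entrywise derivatives and the resolvent of a pencil *)

Section MatrixDerivative.
Variable K : numFieldType.

(** Entrywise with values in [K^o], to agree with [derive_mx] and to reuse the scalar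
    differentiation rules. *)
Definition is_derive_entries p m (F : K -> 'M[K]_(p, m)) (s : K)
    (dF : 'M[K]_(p, m)) : Prop :=
  forall i j, is_derive s 1 (fun z => F z i j : K^o) (dF i j : K^o).

Lemma is_derive_entries_unique p m (F : K -> 'M[K]_(p, m)) s d1 d2 :
  is_derive_entries F s d1 -> is_derive_entries F s d2 -> d1 = d2.
Proof.
move=> D1 D2; apply/matrixP => i j.
by rewrite -(@derive_val _ _ _ _ _ _ _ (D1 i j)) (@derive_val _ _ _ _ _ _ _ (D2 i j)).
Qed.

Lemma near_eq_is_derive_entries p m (F G : K -> 'M[K]_(p, m)) s d :
  (\near s, F s = G s) -> is_derive_entries F s d -> is_derive_entries G s d.
Proof.
move=> FG DF i j; apply: near_eq_is_derive (DF i j).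
by apply: filterS FG => z ->.
Qed.

Lemma is_derive_entries_cst p m (M : 'M[K]_(p, m)) s :
  is_derive_entries (fun=> M) s 0.
Proof. by move=> i j; rewrite mxE; exact: is_derive_cst. Qed.

Lemma is_derive_entriesD_cst p m (M : 'M[K]_(p, m)) (F : K -> 'M[K]_(p, m)) s dF :
  is_derive_entries F s dF -> is_derive_entries (fun z => F z + M) s dF.
Proof.
move=> DF i j; rewrite -[dF i j]addr0.
have -> : (fun z => (F z + M) i j : K^o) =
    (fun z => F z i j : K^o) + cst (M i j : K^o).
  by apply: funext => z; rewrite mxE.
by apply: is_deriveD.
Qed.

Lemma is_derive_entriesM p k m (F : K -> 'M[K]_(p, k)) (G : K -> 'M[K]_(k, m))
    s dF dG :
  is_derive_entries F s dF -> is_derive_entries G s dG ->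
  is_derive_entries (fun z => F z *m G z) s (dF *m G s + F s *m dG).
Proof.
move=> DF DG i j.
have -> : (fun z => (F z *m G z) i j : K^o) =
    \sum_(l < k) ((fun z => F z i l : K^o) * (fun z => G z l j : K^o)).
  by apply: funext => z; rewrite mxE fct_sumE.
have -> : (dF *m G s + F s *m dG) i j =
    \sum_(l < k) (F s i l *: (dG l j : K^o) + G s l j *: (dF i l : K^o)).
  rewrite !mxE -big_split; apply: eq_bigr => l _ /=.
  by rewrite addrC [dF i l * _]mulrC.
by apply: is_derive_sum => l; apply: is_deriveM.
Qed.

Lemma derivable_horner_num (p : {poly K}) (s : K) :
  derivable (fun z => p.[z] : K^o) s 1.
Proof.
elim/poly_ind: p => [|p c IHp].
  have -> : (fun z => (0 : {poly K}).[z] : K^o) = cst 0.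
    by apply: funext => z; rewrite horner0.
  exact: derivable_cst.
have -> : (fun z => (p * 'X + c%:P).[z] : K^o) =
    (fun z => p.[z] : K^o) * (id : K -> K^o) + cst (c : K^o).
  by apply: funext => z; rewrite hornerMXaddC.
by apply: derivableD; [apply: derivableM | apply: derivable_cst].
Qed.

Lemma near_horner_neq0 (p : {poly K}) (s : K) :
  p.[s] != 0 -> \forall z \near s, p.[z] != 0.
Proof.
move=> ps; have := @cvgr_neq0 K K^o K (nbhs s) _ (fun z => p.[z]) p.[s]; apply=> //.
apply: differentiable_continuous.
apply/derivable1_diffP; exact: derivable_horner_num.
Qed.

Section Resolvent.
Variables (n : nat) (A E : 'M[K]_n).

Let resolvent (s : K) := invmx (A - s *: E).

Let pencil : 'M[{poly K}]_n := map_mx polyC A - 'X *: map_mx polyC E.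

Lemma horner_pencil s : map_mx (horner_eval s) pencil = A - s *: E.
Proof.
by apply/matrixP => i j; rewrite !mxE /horner_eval !hornerE.
Qed.

Lemma horner_det_pencil s : (\det pencil).[s] = \det (A - s *: E).
Proof. by rewrite -horner_pencil det_map_mx. Qed.

Lemma unitmx_pencilE s : (A - s *: E \in unitmx) = ((\det pencil).[s] != 0).
Proof. by rewrite unitmxE unitfE horner_det_pencil. Qed.

(** The determinant is a polynomial in [s], hence continuous, so invertibility is an open condition.
    Iterated derivatives rely on this: each must be known around [s], not only at [s]. *)
Lemma near_unitmx_pencil s :
  A - s *: E \in unitmx -> \forall z \near s, A - z *: E \in unitmx.
Proof.
rewrite unitmx_pencilE => /near_horner_neq0.
by apply: filterS => z; rewrite unitmx_pencilE.
Qed.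

(** Cramer's rule: near [s] an entry of the resolvent is a polynomial cofactor divided by the
    polynomial determinant. *)
Lemma derivable_resolvent s i j : A - s *: E \in unitmx ->
  derivable (fun z => resolvent z i j : K^o) s 1.
Proof.
move=> su.
pose f := (fun z => (\det pencil).[z]^-1 : K^o) *
          (fun z => (\adj pencil i j).[z] : K^o).
apply: (@near_eq_derivable _ _ _ f).
  apply: filterS (near_unitmx_pencil su) => z zu.
  rewrite /resolvent /invmx zu mxE -horner_det_pencil -horner_pencil.
  by rewrite -map_mx_adj mxE.
apply: derivableM; last exact: derivable_horner_num.
by apply: derivableV; [rewrite -unitmx_pencilE | exact: derivable_horner_num].
Qed.

Lemma is_derive_resolvent s : A - s *: E \in unitmx ->
  is_derive_entries resolvent s (resolvent s *m E *m resolvent s).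
Proof.
move=> su.
pose dX : 'M[K]_n :=
  \matrix_(i, j) ('D_1 (fun z => resolvent z i j : K^o) s).
have DX : is_derive_entries resolvent s dX.
  by move=> i j; rewrite mxE; apply/derivableP/derivable_resolvent.
have DL : is_derive_entries (fun z => A - z *: E) s (- E).
  move=> i j.
  have -> : (fun z => (A - z *: E) i j : K^o) =
      cst (A i j : K^o) - (id : K -> K^o) * cst (E i j : K^o).
    by apply: funext => z; rewrite !mxE.
  apply: is_derive_eq.
  by rewrite mxE scaler0 !add0r /GRing.scale /= mulr1.
have D1 : is_derive_entries (fun z => (A - z *: E) *m resolvent z) s 0.
  apply: near_eq_is_derive_entries (is_derive_entries_cst 1%:M s).
  by apply: filterS (near_unitmx_pencil su) => z zu; rewrite mulmxV.
(* Differentiating [(A - z *: E) *m resolvent z = 1] in two ways gives [L *m dX = E *m X], with [L]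
   and [X] the values at [s]. *)
have := is_derive_entries_unique (is_derive_entriesM DL DX) D1.
rewrite mulNmx addrC => /subr0_eq LdX.
by rewrite -mulmxA -LdX mulKmx.
Qed.

Lemma is_derive_resolvent_moment s k : A - s *: E \in unitmx ->
  is_derive_entries (fun z => (resolvent z *m E) ^+ k *m resolvent z) s
    (k.+1%:R *: ((resolvent s *m E) ^+ k.+1 *m resolvent s)).
Proof.
move=> su; have DX := is_derive_resolvent su.
elim: k => [|k IHk].
  rewrite scale1r expr1.
  apply: near_eq_is_derive_entries DX.
  by apply: filterE => z; rewrite expr0 mul1mx.
(* Product rule on [X E] times [(X E)^k X]: the first factor contributes one copy of
   [(X E)^(k+2) X], the second [k.+1] copies. *)
have DXE := is_derive_entriesM DX (is_derive_entries_cst E s).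
have := is_derive_entriesM DXE IHk.
rewrite mulmx0 addr0 -scalemxAr.
have -> : resolvent s *m E *m resolvent s *m E *m
    ((resolvent s *m E) ^+ k *m resolvent s) =
    (resolvent s *m E) ^+ k.+2 *m resolvent s.
  by rewrite 2!exprS -!mulmxE !mulmxA.
rewrite mulmxA mulmxE -exprS -mulmxE -[X in X + _]scale1r -scalerDl nat1r.
apply: near_eq_is_derive_entries.
by apply: filterE => z; rewrite exprS -mulmxE !mulmxA.
Qed.

(** The constant [M] stands for [D] at order 0 and for 0 at higher orders, so one rule serves every
    differentiation step. *)
Lemma is_derive_transfer_term p m (B : 'M[K]_(n, m)) (C : 'M[K]_(p, n)) k
    (M : 'M[K]_(p, m)) s : A - s *: E \in unitmx ->
  is_derive_entries
    (fun z => - (k`!%:R *: (C *m (resolvent z *m E) ^+ k *m resolvent z *m B)) + M)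
    s
    (- (k.+1`!%:R *: (C *m (resolvent s *m E) ^+ k.+1 *m resolvent s *m B))).
Proof.
move=> su; have DX := is_derive_resolvent_moment k su.
have DCX := is_derive_entriesM (is_derive_entries_cst (- (k`!%:R *: C)) s) DX.
have := is_derive_entriesM DCX (is_derive_entries_cst B s).
rewrite mulmx0 addr0 mul0mx add0r => DH.
have -> : - (k.+1`!%:R *: (C *m (resolvent s *m E) ^+ k.+1 *m resolvent s *m B)) =
    - (k`!%:R *: C) *m (k.+1%:R *: ((resolvent s *m E) ^+ k.+1 *m resolvent s))
      *m B.
  rewrite !mulNmx -!scalemxAl -!scalemxAr -!scalemxAl scalerA.
  by rewrite factS natrM [_ * k`!%:R]mulrC !mulmxA.
have := is_derive_entriesD_cst M DH.
apply: near_eq_is_derive_entries; apply: filterE => z.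
by rewrite !mulNmx -!scalemxAl !mulmxA.
Qed.

End Resolvent.

End MatrixDerivative.

(** * Derivatives of transfer functions and column spaces *)

Section Transfer.
Variable R : realType.
Local Notation K := R[i].

Lemma transfer_resolvent n m p (A E : 'M[K]_n) (B : 'M[K]_(n, m))
    (C : 'M[K]_(p, n)) (D : 'M[K]_(p, m)) s :
  transfer A E B C D s = - (C *m invmx (A - s *: E) *m B) + D.
Proof. by rewrite /transfer -opprB invmxN mulmxN mulNmx. Qed.

Lemma derive_mxS_near p m (F : K -> 'M[K]_(p, m)) (G : K -> 'M[K]_(p, m)) k s d :
  (\near s, derive_mx F k s = G s) -> is_derive_entries G s d ->
  derive_mx F k.+1 s = d.
Proof.
move=> FG DG; apply/matrixP => i j; rewrite mxE derive1nS derive1E.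
rewrite -(@derive_val _ _ _ _ _ _ _ (DG i j)).
have near_eq := @near_eq_derive K K^o K^o _ _ s 1.
apply: near_eq; apply: filterS FG => z.
by move=> /matrixP/(_ i j); rewrite mxE.
Qed.

Lemma derive_mx_transfer n m p (A E : 'M[K]_n) (B : 'M[K]_(n, m))
    (C : 'M[K]_(p, n)) (D : 'M[K]_(p, m)) k s : A - s *: E \in unitmx ->
  derive_mx (transfer A E B C D) k.+1 s =
  - (k.+1`!%:R *: (C *m (invmx (A - s *: E) *m E) ^+ k.+1
                     *m invmx (A - s *: E) *m B)).
Proof.
(* [s] stays general because the induction hypothesis is applied at all nearby points. *)
elim: k s => [|k IHk] s su.
  apply: derive_mxS_near (is_derive_transfer_term B C 0 D su).
  apply: filterE => z; rewrite expr0 scale1r mulmx1 -transfer_resolvent.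
  by apply/matrixP => i j; rewrite mxE.
apply: derive_mxS_near (is_derive_transfer_term B C k.+1 0 su).
by apply: filterS (near_unitmx_pencil su) => z zu; rewrite addr0 IHk.
Qed.

(** Turns inclusions of subspaces into the factorizations used for moments: each column of [M] lies
    in the image of multiplication by [N], and the chosen preimages are the columns of [Z]. *)
Lemma Ran_subP n k l (M : 'M[K]_(n, k)) (N : 'M[K]_(n, l)) :
  (Ran M <= Ran N)%VS -> exists Z, M = N *m Z.
Proof.
move=> MN; pose f := linfun (mulmx N : 'cV[K]_l -> 'cV[K]_n).
have Nf : (Ran N <= limg f)%VS.
  apply/span_subvP => _ /imageP[j _ ->].
  by rewrite colE -[N *m _](lfunE (mulmx N)) memv_img ?memvf.
have colM j : exists z, col j M = N *m z.
  have : col j M \in limg f.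
    apply: (subvP (subv_trans MN Nf)); apply: memv_span.
    by apply/imageP; exists j.
  by case/memv_imgP => z _ ->; exists z; rewrite lfunE.
have [z zP] := fin_all_exists colM.
exists (\matrix_(i, j) z j i 0); apply/matrixP => i j.
have /matrixP/(_ i 0) := zP j; rewrite !mxE => ->.
by apply: eq_bigr => a _; rewrite mxE.
Qed.

Lemma trmxC_mul m n p (A : 'M[K]_(m, n)) (B : 'M[K]_(n, p)) :
  (A *m B) ^t* = B ^t* *m A ^t*.
Proof. by rewrite trmx_mul map_mxM. Qed.

Lemma PR_cancel m p (Hmu : 'M[K]_(p, m)) :
  (m <= p)%N -> exists Z, PR Hmu *m Z = 1%:M.
Proof.
by rewrite /PR; case: (m <= p)%N => // _; exists 1%:M; rewrite mulmx1.
Qed.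

Lemma PL_cancel m p (Hmu : 'M[K]_(p, m)) :
  (p <= m)%N -> exists Z, Z *m (PL Hmu) ^t* = 1%:M.
Proof.
rewrite /PL; case: (p <= m)%N => // _; exists 1%:M.
by rewrite mul1mx trmx1 map_mx1.
Qed.

Lemma eq_mulmx_scaleN k l n m (P : 'M[K]_(k, l)) (Q : 'M[K]_(n, m)) a
    (M N : 'M[K]_(l, n)) :
  P *m M *m Q = P *m N *m Q ->
  P *m (- (a *: M)) *m Q = P *m (- (a *: N)) *m Q.
Proof.
by move=> PMQ; rewrite !mulmxN !mulNmx -!scalemxAr -!scalemxAl PMQ.
Qed.

End Transfer.

Theorem lemma3p1 (R : realType) (n m p q : nat)
    (A E : 'M[R[i]]_n) (B : 'M[R[i]]_(n, m)) (C : 'M[R[i]]_(p, n))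
    (D : 'M[R[i]]_(p, m)) (mu : R[i]) (calV calW : {vspace 'cV[R[i]]_n}) :
  let H := transfer A E B C D in
  let P_R := PR (H mu) in
  let P_L := PL (H mu) in
  let Vup := (calV + Vmu q A E B (H mu) mu)%VS in
  let Wup := (calW + Wmu q A E C (H mu) mu)%VS in
  standing_assumptions m p A E ->
  ~ finite_eigenvalue A E mu ->
  \dim calV = \dim calW ->
  \dim Vup = \dim Wup ->
  forall (r : nat) (W V : 'M[R[i]]_(n, r)),
  orthonormal_basis_mx W Wup ->
  orthonormal_basis_mx V Vup ->
  let Hred := reduced_transfer A E B C D W V in
  ~ is_pole (W ^t* *m A *m V) (W ^t* *m E *m V) mu ->
  [/\ H mu = Hred mu,
      forall j : nat, (1 <= j <= q)%N ->
        derive_mx H j mu = derive_mx Hred j mu &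
      forall j : nat, (q + 1 <= j <= 2 * q + 1)%N ->
        P_L ^t* *m derive_mx H j mu *m P_R
        = P_L ^t* *m derive_mx Hred j mu *m P_R].
Proof.
move=> H P_R P_L Vup Wup _ mu_reg _ _ r W V [_ WE] [_ VE] Hred not_pole.
have Lu : A - mu *: E \in unitmx.
  (* [root_mu] unfolds to [finite_eigenvalue A E mu]. *)
  rewrite unitmx_pencilE; apply/negP => root_mu; exact: mu_reg.
have pencil_red : W ^t* *m A *m V - mu *: (W ^t* *m E *m V) =
    W ^t* *m (A - mu *: E) *m V.
  by rewrite mulmxBr mulmxBl -scalemxAr -scalemxAl.
have Lru : W ^t* *m (A - mu *: E) *m V \in unitmx.
  move/negP: not_pole; by rewrite negbK -opprB unitmxN pencil_red.
set L := A - mu *: E in Lu Lru pencil_red.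
set X := invmx L.
have span_V j : (j <= q)%N ->
    exists Z, (X *m E) ^+ j *m X *m (B *m P_R) = V *m Z.
  move=> jq; apply: Ran_subP; rewrite VE mulmxA.
  (* The block of index [j] is one summand of [Vmu]. *)
  apply: subv_trans (addvSr _ _); rewrite -ltnS in jq.
  exact: (sumv_sup (Ordinal jq)).
have span_W j : (j <= q)%N ->
    exists Z, P_L ^t* *m C *m X *m (E *m X) ^+ j = Z *m W ^t*.
  move=> jq.
  (* [Wmu] is spanned by columns of conjugate transposes; transposing the factorization back gives
     the statement on rows. *)
  have [Z e] : exists Z, (C *m X *m (E *m X) ^+ j) ^t* *m P_L = W *m Z.
    apply: Ran_subP; rewrite WE.
    apply: subv_trans (addvSr _ _); rewrite -ltnS in jq.
    exact: (sumv_sup (Ordinal jq)).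
  exists (Z ^t*); rewrite -trmxC_mul -e !trmxC_mul !trmxCK.
  by rewrite !mulmxA.
pose Y := V *m invmx (W ^t* *m L *m V) *m W ^t*.
have YE : V *m invmx (W ^t* *m L *m V) *m W ^t* = Y by [].
(* Keeps [mulmxA] from reassociating inside [Y]. *)
clearbody Y.
have low_moments j : (j <= q)%N ->
    C *m (X *m E) ^+ j *m X *m B = C *m (Y *m E) ^+ j *m Y *m B.
  (* If [m <= p], [P_R] is the identity and the columns suffice; otherwise [p <= m], [P_L] is the
     identity and the rows do. *)
  move=> jq; case/orP: (leq_total m p) => mp.
    rewrite -YE; apply/esym.
    exact: galerkin_moment_right (PR_cancel (H mu) mp) span_V j jq.
  rewrite -YE; apply/esym.
  exact: galerkin_moment_left (PL_cancel (H mu) mp) span_W j jq.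
have dH k : derive_mx H k.+1 mu =
    - (k.+1`!%:R *: (C *m (X *m E) ^+ k.+1 *m X *m B)).
  exact: derive_mx_transfer.
have dHred k : derive_mx Hred k.+1 mu =
    - (k.+1`!%:R *: (C *m (Y *m E) ^+ k.+1 *m Y *m B)).
  rewrite derive_mx_transfer pencil_red; last exact: Lru.
  by rewrite reduced_moment YE.
split=> [|j|j].
- have := low_moments 0 isT; rewrite !expr0 !mulmx1 => e.
  rewrite /H /Hred /reduced_transfer !transfer_resolvent pencil_red -/X e -YE.
  by rewrite !mulmxA.
- case: j => [//|j] /andP[_ jq].
  by rewrite dH dHred low_moments.
(* Order 0 is ruled out by [q < j], so [dH] and [dHred] apply. *)
rewrite addn1 mul2n addn1; case: j => [/andP[/notF[]]|j jq].
rewrite dH dHred; apply: eq_mulmx_scaleN.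
rewrite -YE; apply/esym.
exact: galerkin_moment_mid span_V span_W _ jq.
Qed.
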